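(* Let $T$ be a well-formed table, let $k_0,\dots,k_n \in K$, and consider any execution of the parallel composition $\mathrm{Fop}(k_0)\parallel\dots\parallel\mathrm{Fop}(k_n)$ of the simplified find-or-put procedure (described in the context) on $T$. Then: (a) $T$ remains well-formed in every state of the execution; (b) each $\mathrm{Fop}(k_i)$ terminates (returns after finitely many of its own steps), and returns one of $\mathrm{FOUND}$, $\mathrm{FULL}$, $\mathrm{PUT}$; (c) $\mathrm{Fop}(k_i)$ returns $\mathrm{FOUND}$ or $\mathrm{PUT}$ if and only if $k_i$ is in $T$ after its completion; (d) $\mathrm{Fop}(k_i)$ returns $\mathrm{PUT}$ if and only if it has inserted $k_i$ into $T$ (i.e. its compare-and-swap succeeded); (e) if $\mathrm{Fop}(k_i)$ returns $\mathrm{FULL}$, then the slots for $k_i$ are all nonempty and none of them contains $k_i$.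
   Context: Let $K$ be a set of keys and fix positive integers $B_0,B_1$. A table $T=(T_0,T_1)$ consists of a primary array $T_0$ of buckets, each with $B_0$ slots $T_0[c][0..B_0-1]$, and a secondary array $T_1$ of buckets, each with $B_1$ slots $T_1[c][0..B_1-1]$. Each slot holds a distinguished value $\mathrm{EMPTY}$ or another value. Given are address functions $a_0$ (into bucket indices of $T_0$), $a_1,a_2$ (into bucket indices of $T_1$), and remainder functions $r_0,r_1,r_2$ on $K$ with values different from $\mathrm{EMPTY}$. Put $r'_0(k)=r_0(k)$, $r'_1(k)=(r_1(k),0)$, $r'_2(k)=(r_2(k),1)$, $\operatorname{sg}(0)=0$, $\operatorname{sg}(1)=\operatorname{sg}(2)=1$, and $S=\{0\}\times\{0,\dots,B_0-1\}\cup\{1,2\}\times\{0,\dots,B_1-1\}$. For $k\in K$ and $(x,y)\in S$ the $(x,y)$th slot for $k$ is $T_{\operatorname{sg}(x)}[a_x(k)][y]$; it contains $k$ iff its value is $r'_x(k)$; $k$ is in $T$ iff some slot for $k$ contains $k$. The total order $\prec$ on $S$: $(0,y)\prec(1+i,z)$ for all $y,z$, $i\in\{0,1\}$; $(x,y)\prec(x,z)$ iff $y<z$; $(1,y)\prec(2,z)$ iff $y<z$ (equivalently $(2,z)\prec(1,y)$ iff $z\le y$). $T$ is well-formed if (i) every slot of $T_0[c]$ is $\mathrm{EMPTY}$ or $r'_0(k)$ for some $k$ with $a_0(k)=c$, and every slot of $T_1[c]$ is $\mathrm{EMPTY}$ or $r'_x(k)$ for some $x\in\{1,2\}$ and $k$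 with $a_x(k)=c$; and (ii) (order property) whenever $T_{\operatorname{sg}(x)}[a_x(k)][y]=r'_x(k)$, then $T_{\operatorname{sg}(x')}[a_{x'}(k)][y']\notin\{\mathrm{EMPTY},r'_{x'}(k)\}$ for all $(x',y')\prec(x,y)$. Simplified find-or-put $\mathrm{Fop}(k)$, with local snapshot arrays $b_0,b_1,b_2$ (initially all $\mathrm{EMPTY}$): repeat forever: (1) for $x=0,1,2$ copy bucket $T_{\operatorname{sg}(x)}[a_x(k)]$ into $b_x$ slot by slot; (2) if $b_x[y]=r'_x(k)$ for some $(x,y)\in S$, return $\mathrm{FOUND}$; (3) else if $b_x[y]\ne\mathrm{EMPTY}$ for all $(x,y)\in S$, return $\mathrm{FULL}$; (4) else let $(x,y)$ be the $\prec$-minimum of $\{(x,y)\in S: b_x[y]=\mathrm{EMPTY}\}$ and execute $\mathrm{CAS}(T_{\operatorname{sg}(x)}[a_x(k)][y],\mathrm{EMPTY},r'_x(k))$; if it succeeds, return $\mathrm{PUT}$. Here $\mathrm{CAS}(s,\mathrm{EMPTY},v)$ atomically checks whether slot $s$ equals $\mathrm{EMPTY}$ and if so writes $v$ into it and returns true, otherwise returns false. Execution model: finitely many processes run $\mathrm{Fop}$ concurrently, each with its own local variables, sharing only $T$, and no other process accesses $T$; an execution is an arbitrary interleaving of atomic steps, where the only atomic operations on $T$ are single-slot reads and CAS operations (other lines are not atomic).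
   Formalization: The formal theorem additionally assumes that for x = 1 and x = 2 the address and remainder (a_x(k), r_x(k)) determine the key k (without this, (a) can fail), and that equality of remainders is decidable. *)

(* Defs.v *)
From mathcomp Require Import all_boot.

Set Implicit Arguments.
Unset Strict Implicit.
Unset Printing Implicit Defensive.

(* Address functions a0 (primary), a1, a2 (secondary) and remainder functions.
   R0 and R1 are the remainders proper; EMPTY is added in [value] below, so a
   remainder is never EMPTY. A key need not be determined by its address and
   remainder; quotienting, i.e. injectivity of k |-> (a_x(k), r_x(k)), is to be
   assumed separately where it is needed. *)
Record hashing (K : Type) (N0 N1 : nat) (R0 R1 : Type) := Hashing {
  a0 : K -> 'I_N0;
  a1 : K -> 'I_N1;
  a2 : K -> 'I_N1;
  r0 : K -> R0;
  r1 : K -> R1;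
  r2 : K -> R1
}.

(* The index set S: [inl y] stands for (0, y) and [inr (i, y)] for (1 + i, y),
   with i = false, true read as 0, 1. *)
Notation sidx B0 B1 := ('I_B0 + bool * 'I_B1)%type.

Definition hash_of (B0 B1 : nat) (s : sidx B0 B1) : nat :=
  match s with inl _ => 0 | inr (i, _) => i.+1 end.

Definition prec (B0 B1 : nat) (s t : sidx B0 B1) : bool :=
  match s, t with
  | inl y, inl z => y < z
  | inl _, inr _ => true
  | inr _, inl _ => false
  | inr (false, y), inr (true, z) => y < z
  | inr (true, z), inr (false, y) => z <= y
  | inr (_, y), inr (_, z) => y < z
  end.

(* Physical slots: [inl (c, y)] is T_0[c][y] and [inr (c, y)] is T_1[c][y]. *)
Notation loc N0 N1 B0 B1 := ('I_N0 * 'I_B0 + 'I_N1 * 'I_B1)%type.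

(* [Some (inl r)] is a value r'_0 and [Some (inr (r, i))] a value r'_(1+i);
   primary and secondary values share one type, and it is well-formedness that
   keeps each kind in its own array. *)
Definition value (R0 R1 : Type) : Type := option (R0 + R1 * bool).

Definition EMPTY {R0 R1 : Type} : value R0 R1 := None.

Definition table (N0 N1 B0 B1 : nat) (R0 R1 : Type) : Type :=
  loc N0 N1 B0 B1 -> value R0 R1.

Inductive result := FOUND | FULL | PUT.

(* Control points of the procedure. [Copy todo]: the slots in [todo] are still
   to be copied; [Line2], [Line3], [Line4]: about to execute that line on the
   local snapshot; [Cas s]: about to execute the CAS on the slot s; [CasRet ok]:
   the CAS has returned ok, which is still to be tested. *)
Inductive control (B0 B1 : nat) :=
  | Loop
  | Copy of seq (sidx B0 B1)
  | Line2
  | Line3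
  | Line4
  | Cas of sidx B0 B1
  | CasRet of bool
  | Done of result.
Arguments Loop {B0 B1}.
Arguments Line2 {B0 B1}.
Arguments Line3 {B0 B1}.
Arguments Line4 {B0 B1}.
Arguments CasRet {B0 B1}.
Arguments Done {B0 B1}.

(* The snapshot arrays b_0, b_1, b_2 form one function b on S, with b_x[y]
   being b (x, y). *)
Definition snapshot (B0 B1 : nat) (R0 R1 : Type) : Type :=
  sidx B0 B1 -> value R0 R1.

Record local (B0 B1 : nat) (R0 R1 : Type) := Local {
  pc : control B0 B1;
  snap : snapshot B0 B1 R0 R1
}.

Record state (N0 N1 B0 B1 : nat) (R0 R1 : Type) (n : nat) := State {
  tab : table N0 N1 B0 B1 R0 R1;
  proc : 'I_n.+1 -> local B0 B1 R0 R1
}.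

Section Semantics.

Context {K : Type} {N0 N1 B0 B1 : nat} {R0 R1 : eqType}.
Variable H : hashing K N0 N1 R0 R1.

Local Notation sidx := (sidx B0 B1).
Local Notation table := (table N0 N1 B0 B1 R0 R1).
Local Notation snapshot := (snapshot B0 B1 R0 R1).
Local Notation local := (local B0 B1 R0 R1).

Definition slot (k : K) (s : sidx) : loc N0 N1 B0 B1 :=
  match s with
  | inl y => inl (a0 H k, y)
  | inr (false, y) => inr (a1 H k, y)
  | inr (true, y) => inr (a2 H k, y)
  end.

(* r'_x(k) for s = (x, y) *)
Definition rem' (k : K) (s : sidx) : value R0 R1 :=
  match s with
  | inl _ => Some (inl (r0 H k))
  | inr (false, _) => Some (inr (r1 H k, false))
  | inr (true, _) => Some (inr (r2 H k, true))
  end.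

Definition key_in (T : table) (k : K) : Prop :=
  exists s : sidx, T (slot k s) = rem' k s.

Definition well_formed (T : table) : Prop :=
  (forall l, T l = EMPTY \/
     exists (k : K) (s : sidx), slot k s = l /\ T l = rem' k s) /\
  (forall (k : K) (s : sidx), T (slot k s) = rem' k s ->
     forall s' : sidx, prec s' s ->
       T (slot k s') <> EMPTY /\ T (slot k s') <> rem' k s').

Definition first_empty (b : snapshot) (s : sidx) : Prop :=
  b s = EMPTY /\ forall t : sidx, b t = EMPTY -> t <> s -> prec s t.

(* The atomic steps of Fop(k) on the shared table and its own local state.
   Buckets are copied for x = 0, 1, 2 in turn; as the order of the slots within
   a bucket is not prescribed, every such order is allowed. *)
Inductive fop_step (k : K) : table -> local -> table -> local -> Prop :=
  | StepLoop T b (todo : seq sidx) :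
      perm_eq todo (enum {: sidx}) ->
      sorted leq [seq hash_of s | s <- todo] ->
      fop_step k T (Local Loop b) T (Local (Copy todo) b)
  | StepRead T b s todo :
      fop_step k T (Local (Copy (s :: todo)) b)
               T (Local (Copy todo) [eta b with s |-> T (slot k s)])
  | StepCopied T b :
      fop_step k T (Local (Copy [::]) b) T (Local Line2 b)
  | StepFound T b :
      (exists s, b s = rem' k s) ->
      fop_step k T (Local Line2 b) T (Local (Done FOUND) b)
  | StepNotFound T b :
      ~ (exists s, b s = rem' k s) ->
      fop_step k T (Local Line2 b) T (Local Line3 b)
  | StepFull T b :
      (forall s, b s <> EMPTY) ->
      fop_step k T (Local Line3 b) T (Local (Done FULL) b)
  | StepNotFull T b :
      ~ (forall s, b s <> EMPTY) ->
      fop_step k T (Local Line3 b) T (Local Line4 b)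
  | StepSelect T b s :
      first_empty b s ->
      fop_step k T (Local Line4 b) T (Local (Cas s) b)
  | StepCasSuccess T b s :
      T (slot k s) = EMPTY ->
      fop_step k T (Local (Cas s) b)
               [eta T with slot k s |-> rem' k s] (Local (CasRet true) b)
  | StepCasFail T b s :
      T (slot k s) <> EMPTY ->
      fop_step k T (Local (Cas s) b) T (Local (CasRet false) b)
  | StepPut T b :
      fop_step k T (Local (CasRet true) b) T (Local (Done PUT) b)
  | StepRetry T b :
      fop_step k T (Local (CasRet false) b) T (Local Loop b).

Section Parallel.

Variables (n : nat) (k : 'I_n.+1 -> K).
Local Notation state := (state N0 N1 B0 B1 R0 R1 n).

Definition par_step (i : 'I_n.+1) (c c' : state) : Prop :=
  exists T' p', fop_step (k i) (tab c) (proc c i) T' p' /\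
    c' = State T' [eta proc c with i |-> p'].

Definition initial (T : table) : state :=
  State T (fun _ => Local Loop (fun _ => EMPTY)).

(* [sch t] is the process that moves at time t. [None] means that no process
   moves, so that finite executions are those that end up idling. There is no
   fairness assumption. *)
Definition execution (T : table) (sch : nat -> option 'I_n.+1)
    (e : nat -> state) : Prop :=
  e 0 = initial T /\
  forall t, match sch t with
            | Some i => par_step i (e t) (e t.+1)
            | None => e t.+1 = e t
            end.

Definition returned (c : state) (i : 'I_n.+1) (r : result) : Prop :=
  pc (proc c i) = Done r.

(* Termination under an unfair scheduler: until it has returned, process i is
   never blocked; it makes finitely many steps; and it does return unless the
   scheduler abandons it, i.e. stops choosing it before it has returned. *)
Definition terminates (sch : nat -> option 'I_n.+1) (e : nat -> state)
    (i : 'I_n.+1) : Prop :=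
  [/\ forall t, (exists r, returned (e t) i r) \/
                exists c', par_step i (e t) c',
      exists N, forall t, N <= t -> sch t <> Some i
    & (forall t, (exists r, returned (e t) i r) \/
                 exists2 u, t <= u & sch u = Some i) ->
      exists t r, returned (e t) i r].

(* Process i has executed a successful CAS before time t. *)
Definition inserted (sch : nat -> option 'I_n.+1) (e : nat -> state)
    (i : 'I_n.+1) (t : nat) : Prop :=
  exists u s, [/\ u < t, sch u = Some i, pc (proc (e u) i) = Cas s,
                  tab (e u) (slot (k i) s) = EMPTY
                & tab (e u.+1) (slot (k i) s) = rem' (k i) s].

End Parallel.
End Semantics.

(* Main.v *)
Require Import Defs.
From mathcomp Require Import all_boot.
From mathcomp Require Import zify.
From Stdlib Require Import Classical.

(** A slot, once nonempty, never changes. Hence every nonempty snapshot entry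
    agrees with the table for ever, which gives (c) and (e), and a CAS on the
    first empty snapshot entry can only succeed if all earlier slots are
    occupied by other values, which gives the order property. A CAS fails only
    on a slot that was empty in the snapshot but will be seen nonempty in the
    next one, so the number of empty snapshot entries drops in every round. *)

Set Implicit Arguments.
Unset Strict Implicit.
Unset Printing Implicit Defensive.

(** * The order on S as a numerical rank *)

(* With b_1 and b_2 interleaved as (2,0), (1,0), (2,1), (1,1), ..., [rank] is
   the position in the order on S. *)
Definition rank (B0 B1 : nat) (s : sidx B0 B1) : nat :=
  match s with
  | inl y => y
  | inr (i, y) => B0 + y.*2 + ~~ i
  end.

Lemma prec_rank (B0 B1 : nat) (s t : sidx B0 B1) :
  prec s t = (rank s < rank t).
Proof.
case: s t => [y|[[] y]] [z|[[] z]] //=;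
  have := ltn_ord y; have := ltn_ord z; lia.
Qed.

Lemma rank_inj (B0 B1 : nat) : injective (@rank B0 B1).
Proof.
by case=> [y|[[] y]] [[z Hz]|[[] [z Hz]]] /= E; have := ltn_ord y;
  try lia; move=> _; repeat f_equal; apply: val_inj => /=; lia.
Qed.

Section Fop.

Context {K : Type} {N0 N1 B0 B1 : nat} {R0 R1 : eqType}.
Variable H : hashing K N0 N1 R0 R1.

Local Notation sidx := (sidx B0 B1).
Local Notation table := (table N0 N1 B0 B1 R0 R1).
Local Notation snapshot := (snapshot B0 B1 R0 R1).
Local Notation local := (local B0 B1 R0 R1).
Local Notation EMPTY := (@EMPTY R0 R1).

Implicit Types (T : table) (b : snapshot) (p : local) (s : sidx) (k : K).

Lemma rem'_neq_EMPTY k s : rem' H k s <> EMPTY.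
Proof. by case: s => [|[[]]]. Qed.

Lemma first_empty_exists b : ~ (forall s, b s <> EMPTY) -> exists s, first_empty b s.
Proof.
move=> nfull.
have /existsP[s0 s0E] : [exists s, b s == EMPTY].
  apply: contra_notT nfull => /existsPn nE s sE.
  by have := nE s; rewrite sE eqxx.
case: (@arg_minnP _ s0 (fun s => b s == EMPTY) (@rank B0 B1) s0E) => s /eqP sE smin.
exists s; split=> // t tE ts; rewrite prec_rank ltn_neqAle smin ?tE ?eqxx // andbT.
by apply/eqP=> /rank_inj st; apply: ts.
Qed.

(** * Growth of the table and the invariant of one process *)

Definition extends T T' : Prop := forall l, T l <> EMPTY -> T' l = T l.

Lemma extends_put T l v : T l = EMPTY -> extends T [eta T with l |-> v].
Proof. by move=> Tl l' Tl' /=; case: eqP => // E; rewrite E in Tl'. Qed.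

Lemma extends_key_in T T' k : extends T T' -> key_in H T k -> key_in H T' k.
Proof.
move=> TT' [s sk]; exists s; rewrite TT' ?sk //; exact: rem'_neq_EMPTY.
Qed.

Definition full_without k T : Prop :=
  forall s, T (slot H k s) <> EMPTY /\ T (slot H k s) <> rem' H k s.

(** Empty entries are left out: another process may have filled the slot since it was read. Thus the
    condition is stable under [extends]. *)
Definition snap_sound k T b : Prop :=
  forall s, b s <> EMPTY -> T (slot H k s) = b s.

(** Before the CAS returns, absence of the key is asserted of the snapshot only, since in the table
    it is not stable while a slot is empty. The clauses about the table are all stable under
    [extends]. *)
Definition control_ok k T p : Prop :=
  match pc p with
  | Line3 => forall s, snap p s <> rem' H k s
  | Line4 => (forall s, snap p s <> rem' H k s) /\ ~ (forall s, snap p s <> EMPTY)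
  | Cas s => (forall s', snap p s' <> rem' H k s') /\ first_empty (snap p) s
  | CasRet true | Done FOUND | Done PUT => key_in H T k
  | Done FULL => full_without k T
  | _ => True
  end.

Definition local_ok k T p : Prop := snap_sound k T (snap p) /\ control_ok k T p.

Lemma local_ok_extends k T T' p : extends T T' -> local_ok k T p -> local_ok k T' p.
Proof.
move=> TT' [snd ok]; split.
  by move=> s sN; rewrite TT' snd.
have full : full_without k T -> full_without k T'.
  by move=> f s; have [sN sk] := f s; rewrite TT'.
move: ok; rewrite /control_ok; case: (pc p) => //.
  by case=> //; apply: extends_key_in.
by case=> //; apply: extends_key_in.
Qed.

Lemma fop_step_extends k T p T' p' : fop_step H k T p T' p' -> extends T T'.
Proof. by case=> // *; apply: extends_put. Qed.

Lemma fop_step_ok k T p T' p' :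
  fop_step H k T p T' p' -> local_ok k T p -> local_ok k T' p'.
Proof.
case=> {p T' p'} {}T b.
- by move=> todo _ _ [].
- move=> s todo [snd _]; split=> // t /=.
  by case: eqP => [->|_] //; apply: snd.
- by case.
- move=> [s sk] [snd _]; split=> //; exists s.
  by rewrite snd /= sk //; apply: rem'_neq_EMPTY.
- by move=> nk [snd _]; split=> // s sk; apply: nk; exists s.
- move=> full [snd /= nk]; split=> // s; rewrite snd //.
- by move=> nfull [snd nk]; split.
- by move=> s sE [snd [nk _]]; split.
- move=> s sE [snd _]; split=> /=.
    by move=> t tN; rewrite -[RHS](snd t tN); apply: extends_put => //; rewrite snd.
  by exists s; rewrite /= eqxx.
- by move=> s _ [].
- by [].
- by [].
Qed.

(** * Preservation of well-formedness *)

(** A shared secondary value fixes the hash by its tag, and then the key by injectivity. In the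
    primary array the keys may differ, but everything before a primary slot lies in the same bucket
    with the same remainder. *)
Lemma slot_rem'_inj (inj1 : injective (fun k => (a1 H k, r1 H k)))
    (inj2 : injective (fun k => (a2 H k, r2 H k))) k k' s t :
  slot H k s = slot H k' t :> loc N0 N1 B0 B1 -> rem' H k s = rem' H k' t ->
  s = t /\ forall s', prec s' s ->
    slot H k s' = slot H k' s' :> loc N0 N1 B0 B1 /\ rem' H k s' = rem' H k' s'.
Proof.
case: s t => [y|[[] y]] [z|[[] z]] //= [Ea Ey] [Er]; subst z.
- by split=> // -[y'|[[] y']] //=; rewrite Ea Er.
- by have -> : k = k' by apply: inj2; rewrite /= Ea Er.
- by have -> : k = k' by apply: inj1; rewrite /= Ea Er.
Qed.

Lemma put_well_formed (inj1 : injective (fun k => (a1 H k, r1 H k)))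
    (inj2 : injective (fun k => (a2 H k, r2 H k))) k T s :
  well_formed H T -> T (slot H k s) = EMPTY ->
  (forall s', prec s' s ->
     T (slot H k s') <> EMPTY /\ T (slot H k s') <> rem' H k s') ->
  well_formed H [eta T with slot H k s |-> rem' H k s].
Proof.
move=> [vals ord] sE before; split=> [l|k' t] /=.
  by case: eqP => [->|_]; [right; exists k, s | apply: vals].
case: eqP => [st|_] E s' s't.
  have [st' same] := slot_rem'_inj inj1 inj2 (esym st) E.
  rewrite -st' in s't; have [-> ->] : slot H k' s' = slot H k s' :> loc N0 N1 B0 B1
      /\ rem' H k' s' = rem' H k s' by have [-> ->] := same _ s't.
  have := before _ s't; case: eqP => // -> [] //.
(* The filled slot was empty, so by the old order property it precedes no occupied slot of [k']. *)
have := ord _ _ E _ s't; case: eqP => // -> [] //.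
Qed.

Lemma fop_step_well_formed (inj1 : injective (fun k => (a1 H k, r1 H k)))
    (inj2 : injective (fun k => (a2 H k, r2 H k))) k T p T' p' :
  fop_step H k T p T' p' -> local_ok k T p -> well_formed H T -> well_formed H T'.
Proof.
case=> // {p T' p'} {}T b s sE [/= snd [/= nk [_ smin]]] wfT.
apply: put_well_formed => // t ts.
(* By minimality of [s], earlier entries are nonempty, so the table still holds them, and none was
   the key's value. *)
have tN : b t <> EMPTY.
  move=> tE; have ts' : t <> s by move=> E; rewrite E prec_rank ltnn in ts.
  have := smin _ tE ts'; move: ts; rewrite !prec_rank; lia.
by rewrite snd.
Qed.

(** * Progress and the termination measure *)

Lemma fop_step_exists k T p :
  local_ok k T p ->
  (exists r, pc p = Done r) \/ exists T' p', fop_step H k T p T' p'.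
Proof.
case: p => [[|[|s todo]||||s|[]|r] b] [/= snd ok]; [right..|].
- pose r := relpre (@hash_of B0 B1) leq.
  exists T, (Local (Copy (sort r (enum {: sidx}))) b).
  apply: StepLoop; first by rewrite perm_sort.
  rewrite sorted_map; apply: sort_sorted => s t; exact: leq_total.
- by do 2 eexists; apply: StepCopied.
- by do 2 eexists; apply: StepRead.
- case: (boolP [exists s, b s == rem' H k s]) => [/existsP[s /eqP sk]|/existsPn nk].
    by do 2 eexists; apply: StepFound; exists s.
  by do 2 eexists; apply: StepNotFound => -[s /eqP sk]; move: (nk s); rewrite sk.
- case: (boolP [exists s, b s == EMPTY]) => [/existsP[s /eqP sE]|/existsPn nE].
    by do 2 eexists; apply: StepNotFull => /(_ s).
  by do 2 eexists; apply: StepFull => s /eqP sE; move: (nE s); rewrite sE.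
- have [s sE] := first_empty_exists ok.2.
  by do 2 eexists; apply: StepSelect sE.
- by case: (T (slot H k s) =P EMPTY) => sE; do 2 eexists;
    [apply: StepCasSuccess | apply: StepCasFail].
- by do 2 eexists; apply: StepPut.
- by do 2 eexists; apply: StepRetry.
- by left; exists r.
Qed.

(** The entries certain to be overwritten before the snapshot is next examined. *)
Definition pending p s : bool :=
  match pc p with
  | Loop | CasRet false => true
  | Copy todo => s \in todo
  | _ => false
  end.

(* The slots that would still be empty in the snapshot if all pending reads
   were performed on [T] now. *)
Definition unseen k T p : {set sidx} :=
  [set s | (snap p s == EMPTY) && (pending p s ==> (T (slot H k s) == EMPTY))].

(** The maximal number of own steps up to the return if no further CAS fails. *)
Definition position p : nat :=
  match pc p with
  | CasRet false => #|{: sidx}| + 8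
  | Loop => #|{: sidx}| + 7
  | Copy todo => size todo + 6
  | Line2 => 5
  | Line3 => 4
  | Line4 => 3
  | Cas _ => 2
  | CasRet true => 1
  | Done _ => 0
  end.

(* The factor exceeds every value of [position], so that the measure decreases
   when [position] is reset by a failed CAS. *)
Definition fop_measure k T p : nat :=
  #|unseen k T p| * (#|{: sidx}| + 9) + position p.

Lemma unseen_extends k T T' p : extends T T' -> unseen k T' p \subset unseen k T p.
Proof.
move=> TT'; apply/subsetP => s; rewrite !inE => /andP[-> /=].
case: (pending p s) => //=.
by case: (T _ =P EMPTY) => // sN; rewrite TT' //; move/eqP.
Qed.

Lemma fop_measure_extends k T T' p :
  extends T T' -> fop_measure k T' p <= fop_measure k T p.
Proof.
by move=> TT'; rewrite leq_add2r leq_mul2r subset_leq_card ?orbT ?unseen_extends.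
Qed.

Lemma fop_measure_lt k T p T' p' :
  unseen k T' p' \subset unseen k T p -> position p' < position p ->
  fop_measure k T' p' < fop_measure k T p.
Proof.
move=> /subset_leq_card le lt; rewrite /fop_measure -addnS.
by apply: leq_add => //; rewrite leq_mul2r le orbT.
Qed.

Lemma fop_step_measure k T p T' p' :
  fop_step H k T p T' p' -> local_ok k T p ->
  fop_measure k T' p' < fop_measure k T p.
Proof.
case=> {p T' p'} {}T b.
- move=> todo pe _ _; apply: fop_measure_lt; last first.
    by rewrite /position /= (perm_size pe) -cardE ltn_add2l.
  by apply/subsetP => s; rewrite !inE /pending /= (perm_mem pe) mem_enum.
- move=> s todo [/= snd _]; apply: fop_measure_lt => //.
  apply/subsetP => t; rewrite !inE /pending /= !inE.
  case: (t =P s) => [->|_] //= /andP[/eqP sE _].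
  (* A nonempty old entry would agree with the table, where the slot has just been read as empty. *)
  rewrite sE eqxx andbT; case: (b s =P EMPTY) => // sN.
  by case: (sN); rewrite -snd.
- by move=> _; apply: fop_measure_lt.
- by move=> _ _; apply: fop_measure_lt.
- by move=> _ _; apply: fop_measure_lt.
- by move=> _ _; apply: fop_measure_lt.
- by move=> _ _; apply: fop_measure_lt.
- by move=> s _ _; apply: fop_measure_lt.
- by move=> s _ _; apply: fop_measure_lt.
- move=> s sN [/= _ [/= _ [sE _]]].
  (* The slot [s] drops out: it is empty in the snapshot, but now pending and nonempty in the table.
     This outweighs the rise of [position] from 2 to [#|{: sidx}| + 8]. *)
  have : #|unseen k T (Local (CasRet false) b)| < #|unseen k T (Local (Cas s) b)|.
    apply: proper_card; apply/properP; split.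
      by apply/subsetP => t; rewrite !inE /pending /= => /andP[->].
    exists s; rewrite !inE /pending /= sE eqxx //=.
    by apply/eqP.
  rewrite /fop_measure /position /=; nia.
- by move=> _; apply: fop_measure_lt.
- move=> _; apply: fop_measure_lt; last by rewrite /position /=; lia.
  by apply/subsetP => t; rewrite !inE /pending.
Qed.

(** * Successful CAS operations *)

(** No step leaves these control points, so the current state records whether a CAS has
    succeeded. *)
Definition after_put p : bool :=
  match pc p with CasRet true | Done PUT => true | _ => false end.

Lemma fop_step_after_put k T p T' p' :
  fop_step H k T p T' p' -> after_put p -> after_put p'.
Proof. by case. Qed.

Lemma fop_step_put k T p T' p' :
  fop_step H k T p T' p' -> after_put p' ->
  after_put p \/
  exists s, [/\ pc p = Cas s, T (slot H k s) = EMPTY & T' (slot H k s) = rem' H k s].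
Proof.
case=> // {p T' p'} {}T b; last by left.
by move=> s sE _; right; exists s; rewrite /= eqxx.
Qed.

Lemma fop_step_cas k T p T' p' s :
  fop_step H k T p T' p' -> pc p = Cas s -> T (slot H k s) = EMPTY -> after_put p'.
Proof. by case=> // {p T' p'} {}T b t tN [<-]. Qed.

(** * Whole executions *)

Section Execution.

Context {n : nat}.
Variables (k : 'I_n.+1 -> K) (T : table).
Variables (sch : nat -> option 'I_n.+1) (e : nat -> state N0 N1 B0 B1 R0 R1 n).
Hypothesis inj1 : injective (fun k => (a1 H k, r1 H k)).
Hypothesis inj2 : injective (fun k => (a2 H k, r2 H k)).
Hypothesis wfT : well_formed H T.
Hypothesis exec : execution H k T sch e.

Lemma execution_step t :
  (exists i, [/\ sch t = Some i,
     fop_step H (k i) (tab (e t)) (proc (e t) i) (tab (e t.+1)) (proc (e t.+1) i) &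
     forall j, j != i -> proc (e t.+1) j = proc (e t) j])
  \/ sch t = None /\ e t.+1 = e t.
Proof.
have := exec.2 t; case: (sch t) => [i|] st; [left; exists i | by right].
have [T' [p' [step ->]]] := st; split=> //=; first by rewrite eqxx.
by move=> j /negPf ->.
Qed.

Lemma execution_extends t : extends (tab (e t)) (tab (e t.+1)).
Proof.
by have [[i [_ /fop_step_extends ? _]]|[_ ->]] := execution_step t.
Qed.

Lemma execution_ok t :
  well_formed H (tab (e t)) /\ forall i, local_ok (k i) (tab (e t)) (proc (e t) i).
Proof.
elim: t => [|t [wf ok]]; first by rewrite exec.1; split=> // i; split.
have [[i [_ step other]]|[_ ->]] // := execution_step t.
split; first exact: fop_step_well_formed step (ok i) wf.
move=> j; have [->|ji] := eqVneq j i; first exact: fop_step_ok step (ok i).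
by rewrite other //; apply: local_ok_extends (ok j); apply: execution_extends.
Qed.

(** The boolean summand charges one unit for each step of process [i]. *)
Lemma execution_measure i t :
  fop_measure (k i) (tab (e t.+1)) (proc (e t.+1) i) + (sch t == Some i)
    <= fop_measure (k i) (tab (e t)) (proc (e t) i).
Proof.
have [[j [-> step other]]|[-> ->]] := execution_step t; last by rewrite addn0.
have [ij|ij] := eqVneq i j.
  by subst j; rewrite eqxx addn1; apply: fop_step_measure step _; apply: (execution_ok t).2.
rewrite other // (_ : (Some j == Some i) = false) ?addn0.
  by apply: fop_measure_extends; apply: execution_extends.
by apply/eqP=> -[E]; rewrite E eqxx in ij.
Qed.

Lemma execution_finite i : exists N, forall t, N <= t -> sch t <> Some i.
Proof.
pose m t := fop_measure (k i) (tab (e t)) (proc (e t) i).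
have m_le t u : t <= u -> m u <= m t.
  move=> /subnK <-; elim: (u - t) => //= d; apply: leq_trans.
  by rewrite addSn; apply: leq_trans (execution_measure i _); apply: leq_addr.
suff : forall c t0, m t0 <= c -> exists N, forall t, N <= t -> sch t <> Some i.
  by move/(_ (m 0) 0 (leqnn _)).
elim=> [|c IHc] t0 le_c.
  exists t0 => t /m_le le_t sch_t; have := execution_measure i t.
  rewrite sch_t eqxx -/(m t) -/(m t.+1); lia.
(* If [i] moves again, at time [t], the bound has dropped by [t.+1]; otherwise [t0] is the required
   [N]. *)
have [[t [t0t sch_t]]|none] := classic (exists t, t0 <= t /\ sch t = Some i).
  apply: (IHc t.+1); have := m_le _ _ t0t; have := execution_measure i t.
  rewrite sch_t eqxx -/(m t) -/(m t.+1); lia.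
by exists t0 => t t0t sch_t; apply: none; exists t.
Qed.

Lemma execution_terminates i : terminates H k sch e i.
Proof.
have [N noN] := execution_finite i; split; last 1 first.
(* From [N] on process [i] is never chosen, so at [N] it must have returned. *)
- move=> fair; have [[r ret]|[u Nu sch_u]] := fair N; first by exists N, r.
  by case: (noN u Nu).
- move=> t; have [ret|[T' [p' step]]] := fop_step_exists ((execution_ok t).2 i).
    by left.
  by right; eexists; exists T', p'.
- by exists N.
Qed.

Lemma after_put_inserted i t :
  after_put (proc (e t) i) <-> inserted H k sch e i t.
Proof.
split.
  elim: t => [|t IHt]; first by rewrite exec.1.
  have mono : inserted H k sch e i t -> inserted H k sch e i t.+1.
    by move=> [u [s [ut ? ? ? ?]]]; exists u, s; split=> //; apply: ltnW.
  have [[j [sch_t step other]]|[_ ->]] := execution_step t; last by move/IHt.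
  have [ij|ij] := eqVneq i j; last by rewrite other // => /IHt.
  subst j; move/(fop_step_put step) => [/IHt //|[s [? ? ?]]].
  by exists t, s.
move=> [u [s [ut sch_u pc_u sE _]]].
have put_u : after_put (proc (e u.+1) i).
  have [[j [sch_j step _]]|[]] := execution_step u; last by rewrite sch_u.
  by move: sch_j step; rewrite sch_u => -[<-] step; apply: fop_step_cas step pc_u sE.
rewrite -(subnK ut); elim: (t - u.+1) => //= d IHd; rewrite addSn.
have [[j [_ step other]]|[_ ->]] // := execution_step (d + u.+1).
have [ij|ij] := eqVneq i j; last by rewrite other.
by subst j; apply: fop_step_after_put step IHd.
Qed.

Lemma returned_control_ok i t r :
  returned (e t) i r ->
  control_ok (k i) (tab (e t)) (Local (Done r) (snap (proc (e t) i))).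
Proof.
by rewrite /returned => ret; have [_] := (execution_ok t).2 i; rewrite /control_ok ret.
Qed.

End Execution.

End Fop.

Theorem theorem1 (K : Type) (N0 N1 B0 B1 : nat) (R0 R1 : eqType)
    (H : hashing K N0 N1 R0 R1)
    (hB0 : 0 < B0) (hB1 : 0 < B1)
    (inj1 : injective (fun k => (a1 H k, r1 H k)))
    (inj2 : injective (fun k => (a2 H k, r2 H k)))
    (T : table N0 N1 B0 B1 R0 R1) (wfT : well_formed H T)
    (n : nat) (k : 'I_n.+1 -> K)
    (sch : nat -> option 'I_n.+1) (e : nat -> state N0 N1 B0 B1 R0 R1 n)
    (exec : execution H k T sch e) :
  [/\ (* (a) *)
      forall t, well_formed H (tab (e t)),
      (* (b) *)
      forall i, terminates H k sch e i,
      (* (c) *)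
      forall i t r, returned (e t) i r ->
        (r = FOUND \/ r = PUT <-> key_in H (tab (e t)) (k i)),
      (* (d) *)
      forall i t r, returned (e t) i r ->
        (r = PUT <-> inserted H k sch e i t)
    & (* (e) *)
      forall i t, returned (e t) i FULL ->
        forall s, tab (e t) (slot H (k i) s) <> EMPTY /\
                  tab (e t) (slot H (k i) s) <> rem' H (k i) s].
Proof.
have ok := execution_ok inj1 inj2 wfT exec.
have ret_ok := returned_control_ok inj1 inj2 wfT exec.
split.
- by move=> t; apply: (ok t).1.
- exact: execution_terminates inj1 inj2 wfT exec.
- move=> i t r /ret_ok; case: r => [kin|full|kin]; first by split=> //; left.
    split=> [[]//|[s sk]]; by case: (full s).
  by split=> //; right.
- move=> i t r ret; rewrite -(after_put_inserted exec) /after_put ret.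
  by case: {ret} r.
- by move=> i t /ret_ok.
Qed.
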